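(* Let $q\ge 2$ and $k\ge 2$. For any words $w,w'\in[q]^k$, the graphs $L_w$ and $L_{w'}$ are isomorphic as unlabeled directed graphs if and only if there is a permutation $\pi$ of the alphabet $[q]$ such that $\pi(w_i)=w'_i$ for $i=1,2,\dots,k$.
   Context: $[q]=\{0,\dots,q-1\}$. For $w=w_1\cdots w_k\in[q]^k$, $a\in[q]$ and $1\le i\le k-1$, let $d_i(a)=\max\{j : 1\le j\le i+1,\ w_1w_2\cdots w_j = w_{i-j+2}w_{i-j+3}\cdots w_i a\}$ (the length of the longest prefix of $w$ that is a suffix of $w_1\cdots w_i a$), with $d_i(a)=*a$ (a formal symbol) if the set of such $j$ is empty. $L_w$ is the directed edge-labeled graph with vertex set $\{*a: a\in[q]\setminus\{w_1\}\}\cup\{1,2,\dots,k-1\}$ and the following edges: for each $a,b\in[q]\setminus\{w_1\}$, an edge $*a\to *b$ labeled $b$; for each $a\in[q]\setminus\{w_1\}$, an edge $*a\to 1$ labeled $w_1$; for each $a\in[q]$ and $1\le i\le k-1$, except for $a=w_k$ and $i=k-1$, an edge $i\to d_i(a)$ labeled $a$. Isomorphism here means isomorphism of the underlying unlabeled directed graphs, regardless of how it transforms edge or vertex labels. *)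

(* Defs.v *)
From mathcomp Require Import all_boot all_fingroup.
From mathcomp Require Import zify.

Set Implicit Arguments.
Unset Strict Implicit.
Unset Printing Implicit Defensive.

(* [letter w i a] : the i-th letter of w is a, with i counted from 1. *)
Definition letter q k (w : k.-tuple 'I_q) (i : nat) (a : 'I_q) : bool :=
  onth w i.-1 == Some a.

(* Lengths of the nonempty prefixes w_1...w_j (j <= i+1) of w that are
   suffixes w_(i-j+2)...w_i a of the word w_1...w_i a. *)
Definition dset q k (w : k.-tuple 'I_q) (i : nat) (a : 'I_q) : seq nat :=
  [seq j <- iota 1 i.+1 | take j w == drop (i.+1 - j) (rcons (take i w) a)].

(* [inl a] is the formal symbol *a and [inr j] is the number j. *)
Definition d q k (w : k.-tuple 'I_q) (i : nat) (a : 'I_q) : 'I_q + nat :=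
  if dset w i a is [::] then inl a else inr (\max_(j <- dset w i a) j).

(* The symbols *a with a <> w_1, and the numbers 1, ..., k-1. *)
Definition Lvertex q k (w : k.-tuple 'I_q) : finType :=
  ({a : 'I_q | ~~ letter w 1 a} + {i : 'I_k | 0 < i})%type.

Definition vname q k (w : k.-tuple 'I_q) (x : Lvertex w) : 'I_q + nat :=
  match x with
  | inl a => inl (val a)
  | inr i => inr (val (val i))
  end.

(* [Ledge x c y] : L_w has an edge from x to y labeled c. *)
Definition Ledge q k (w : k.-tuple 'I_q) (x : Lvertex w) (c : 'I_q)
    (y : Lvertex w) : bool :=
  match vname x, vname y with
  | inl _, inl b => c == b
  | inl _, inr j => (j == 1) && letter w 1 c
  | inr i, _ => ~~ ((i == k.-1) && letter w k c) && (vname y == d w i c)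
  end.

(* L_w has no parallel edges (see [Ledge_label_uniq]), so a relation captures
   the underlying unlabeled directed graph, which may have loops. *)
Definition Larc q k (w : k.-tuple 'I_q) : rel (Lvertex w) :=
  fun x y => [exists c, Ledge x c y].

Definition digraph_iso (V V' : finType) (e : rel V) (e' : rel V') : Prop :=
  exists2 f : V -> V', bijective f & forall x y, e x y = e' (f x) (f y).

Lemma vname_inj q k (w : k.-tuple 'I_q) : injective (@vname q k w).
Proof.
by move=> [a|i] [b|j] //= [] /val_inj; [|move/val_inj] => ->.
Qed.

Variant d_spec q k (w : k.-tuple 'I_q) i (a : 'I_q) : 'I_q + nat -> Prop :=
| DStar of (forall j, 0 < j <= i.+1 ->
              take j w != drop (i.+1 - j) (rcons (take i w) a)) :
    d_spec w i a (inl a)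
| DPos j of 0 < j <= i.+1
    & take j w = drop (i.+1 - j) (rcons (take i w) a)
    & (forall j', 0 < j' <= i.+1 ->
         take j' w = drop (i.+1 - j') (rcons (take i w) a) -> j' <= j) :
    d_spec w i a (inr j).

Lemma dP q k (w : k.-tuple 'I_q) i (a : 'I_q) : d_spec w i a (d w i a).
Proof.
have memd j : (j \in dset w i a) =
    (take j w == drop (i.+1 - j) (rcons (take i w) a)) && (0 < j <= i.+1).
  by rewrite mem_filter mem_iota add1n ltnS.
have maxJ (s : seq nat) : s != [::] -> \max_(j <- s) j \in s.
  elim: s => // x [|y s] IH _; first by rewrite big_seq1 inE.
  rewrite big_cons in_cons; move: (bigop.body _ _ _) (IH isT).
  by move=> m hm; rewrite /maxn; case: ifP; rewrite ?hm ?eqxx ?orbT.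
rewrite /d; case E: (dset w i a) => [|x s].
  by apply: DStar => j hj; move: (memd j); rewrite E hj andbT in_nil => <-.
have := maxJ (dset w i a); rewrite E => /(_ isT); rewrite -E memd.
case/andP => /eqP h1 h2; apply: DPos => // j hj /eqP ej.
by apply: (@leq_bigmax_seq _ _ xpredT id) => //; rewrite memd ej hj.
Qed.

Lemma last_d q k (w : k.-tuple 'I_q) i a j :
  i < k -> d w i a = inr j -> letter w j a.
Proof.
move=> ik; case: dP => // j' /andP[j0 ji] E _ [<-].
have sz : size (take i w) = i by rewrite size_takel // size_tuple ltnW.
have jk : j' <= size w by rewrite size_tuple (leq_trans ji).
have F : last a (take j' w) = a.
  by rewrite E drop_rcons ?sz ?last_rcons //; lia.
have G : nth a w j'.-1 = a.
  by rewrite -[RHS]F -nth_last size_takel // nth_take ?ltn_predL.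
apply/eqP; rewrite onthE (nth_map a) ?G // prednK //.
Qed.

Lemma Ledge_label_uniq q k (w : k.-tuple 'I_q) (x y : Lvertex w) a b :
  Ledge x a y -> Ledge x b y -> a = b.
Proof.
have letter_inj i c c' : letter w i c -> letter w i c' -> c = c'.
  by rewrite /letter => /eqP -> /eqP[].
rewrite /Ledge; case: x => [x|i] /=.
  case: y => [y|j] /=; first by move=> /eqP -> /eqP.
  by move=> /andP[_ la] /andP[_]; apply: letter_inj la.
have ik := ltn_ord (val i).
move=> /andP[_ /eqP ea] /andP[_ /eqP eb].
case E: (vname y) => [c|j]; move: ea eb; rewrite E => /esym ea /esym eb.
  by move: ea eb; case: dP => // _ [->]; case: dP => // _ [->].
exact: letter_inj (last_d ik ea) (last_d ik eb).
Qed.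

Lemma Ledge_target q k (w : k.-tuple 'I_q) (i : {i : 'I_k | 0 < i}) a :
  ~~ ((val i == k.-1 :> nat) && letter w k a) ->
  exists y : Lvertex w, Ledge (inr i : Lvertex w) a y.
Proof.
move=> ex; have ik := ltn_ord (val i); rewrite /Ledge /= ex /=.
have sz : size (take (val i) w) = val i by rewrite size_takel // size_tuple ltnW.
case E: (d w (val i) a) => [c|j].
  have na : ~~ letter w 1 c.
    move: E; case: dP => // /(_ 1 isT) h [<-]; apply: contra h => la.
    rewrite subSS subn0 drop_rcons ?sz // drop_oversize ?sz //.
    by move: la; rewrite /letter /=; case: (tval w) => //= x s /eqP [->]; rewrite take0.
  by exists (inl (exist _ c na)) => /=.
have lj := last_d ik E.
have /andP[j0 ji] : 0 < j <= (val i).+1 by move: E; case: dP => // ? ? _ _ [<-].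
have jk : j < k.
  rewrite ltnNge; apply: contra ex => kj.
  have ek : j = k by lia.
  by apply/andP; split; [apply/eqP; lia | rewrite ek in lj].
by exists (inr (exist (fun i : 'I_k => 0 < i) (Ordinal jk) j0)) => /=.
Qed.

(* Main.v *)
Require Import Defs.
From mathcomp Require Import all_boot all_fingroup.
From mathcomp Require Import zify.

Set Implicit Arguments.
Unset Strict Implicit.
Unset Printing Implicit Defensive.

(** All edges into a given vertex y carry the same label, [lab y]: the letter a
    for the symbol *a, and w_j for the number j.  So L_w is a deterministic
    automaton whose labels sit on its vertices, and its unlabeled graph recovers
    w up to renaming as soon as one knows which vertex has which number.

    The numbers are visible in the graph.  Give *a the rank 0 and j the rank j.
    Only the vertex k-1 has an outdegree other than q ([card_out]), and along an
    edge the rank rises by at most one, while every x has an edge to each vertex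
    of rank one more.  Hence k-1-[rank x] is the distance from x to k-1, and an
    isomorphism f preserves the rank ([iso_rank]).

    A vertex of rank 0 has exactly one edge for each letter c; following f on
    these edges gives a permutation pi of the letters.  Then f renames all labels
    by pi ([iso_lab]): for j > 1, the edges from j-1 lead to j and to vertices of
    smaller rank, where this is known by induction, and the label of j is the one that
    the latter leave over.  Comparing the labels of the vertices of rank j gives
    pi w_j = w'_j for j < k, and pi w_k = w'_k because w_k is the one letter
    without an edge from k-1 ([iso_perm]).

    Conversely the failure function d only compares letters for equality, so
    renaming the letters renames the graph ([perm_Ledge]). *)

(** * Ranks and labels of vertices *)

Definition rank q k (w : k.-tuple 'I_q) (x : Lvertex w) : nat :=
  if x is inr i then val (val i) else 0.

(** The letter for which the vertex is entered; see [Ledge_lab].  The ordinal is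
    the 0-based position of w_i. *)
Definition lab q k (w : k.-tuple 'I_q) (y : Lvertex w) : 'I_q :=
  match y with
  | inl a => val a
  | inr i =>
      tnth w (Ordinal (leq_ltn_trans (leq_pred (val i)) (ltn_ord (val i))))
  end.

Definition out q k (w : k.-tuple 'I_q) (x : Lvertex w) : {set Lvertex w} :=
  [set y | Larc x y].

Section Graph.
Variables (q k : nat) (w : k.-tuple 'I_q).
Implicit Types (x y z : Lvertex w) (a c : 'I_q).

Lemma letter_tnth j (i : 'I_k) c : j.-1 = i -> letter w j c = (tnth w i == c).
Proof.
move=> ji; rewrite /letter ji onthE (nth_map c) ?size_tuple //.
by rewrite (tnth_nth c); apply/eqP/eqP => [[]|->].
Qed.

Lemma rank_lt x : 0 < k -> rank x < k.
Proof. by case: x => [a|i] //= _; apply: ltn_ord. Qed.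

Lemma rank_inj x y : 0 < rank x -> rank x = rank y -> x = y.
Proof.
case: x y => [a|i] [b|j] //= i0; first by move=> e; rewrite e in i0.
by move=> /val_inj/val_inj ->.
Qed.

Lemma ex_rank i : 0 < i < k -> exists x, rank x = i.
Proof.
by case/andP=> i0 ik; exists (inr (exist (fun i : 'I_k => 0 < i) (Ordinal ik) i0)).
Qed.

Lemma lab_rank (i : 'I_k) y : rank y = i.+1 -> lab y = tnth w i.
Proof.
case: y => [a|j] //= ji; congr (tnth w _).
by apply: val_inj; rewrite /= ji.
Qed.

(** This is what makes the labels recoverable: they belong to the targets of
    the edges, because d_i(a) is the length of a prefix that ends in a. *)
Lemma Ledge_lab x c y : Ledge x c y -> c = lab y.
Proof.
have lab1 (j : {i : 'I_k | 0 < i}) : letter w (val (val j)) c ->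
    c = lab (inr j : Lvertex w).
  by rewrite (@letter_tnth _ (Ordinal (leq_ltn_trans (leq_pred (val j))
    (ltn_ord (val j))))) // => /eqP <-.
case: x => [a|i]; case: y => [b|j]; rewrite /Ledge.
- by move/eqP.
- by case/andP=> /eqP /= j1; rewrite -{1}j1 => /lab1.
- by case/andP=> _ /eqP /=; case: dP => // _ [].
- by case/andP=> _ /eqP /= /esym /(last_d (ltn_ord _)) /lab1.
Qed.

Lemma LarcE x y : Larc x y = Ledge x (lab y) y.
Proof.
apply/existsP/idP => [[c e]|e]; last by exists (lab y).
by rewrite -(Ledge_lab e).
Qed.

Lemma Ledge_inj x c y z : Ledge x c y -> Ledge x c z -> y = z.
Proof.
move=> ey ez; apply: vname_inj; move: ey ez; rewrite /Ledge.
case: x => [a|i] /=; last by move=> /andP[_ /eqP ->] /andP[_ /eqP ->].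
case: y z => [[b nb]|i] [[b' nb']|j] //=.
- by move=> /eqP <- /eqP <-.
- by move=> /eqP -> /andP[_]; rewrite (negPf nb).
- by move=> /andP[_ l1] /eqP e; move: nb'; rewrite -e l1.
- by move=> /andP[/eqP -> _] /andP[/eqP -> _].
Qed.

Lemma Larc_lab_inj x y z : Larc x y -> Larc x z -> lab y = lab z -> y = z.
Proof. by rewrite !LarcE => ey ez e; apply: Ledge_inj ey _; rewrite e. Qed.

(** The missing edge of label w_k at k-1 is the only gap in the automaton. *)
Lemma Ledge_total x c : 1 < k -> (rank x = k.-1 -> ~~ letter w k c) ->
  exists y, Ledge x c y.
Proof.
move=> k1; case: x => [a|i] /= nl; last first.
  by apply: Ledge_target; case: eqP => //= /nl.
have [l1|n1] := boolP (letter w 1 c).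
  have [y y1] := @ex_rank 1 k1.
  by exists y; case: y y1 => [//|j] /= j1; rewrite /Ledge /= j1 l1.
by exists (inl (exist _ c n1)); rewrite /Ledge /=.
Qed.

Lemma Larc_rank x y : Larc x y -> rank y <= (rank x).+1.
Proof.
rewrite LarcE /Ledge; case: x y => [a|i] [b|j] //=.
  by case/andP=> /eqP j1 _; rewrite j1.
by case/andP=> _ /eqP; case: dP => // m /andP[_ mi] _ _ [->].
Qed.

(** Reading the next letter of w extends the matched prefix w_1...w_i to
    w_1...w_(i+1), the longest value allowed. *)
Lemma d_succ i c : i < k -> letter w i.+1 c -> d w i c = inr i.+1.
Proof.
move=> ik; rewrite (@letter_tnth _ (Ordinal ik)) // (tnth_nth c) => /eqP /= wi.
have E : take i.+1 w = drop (i.+1 - i.+1) (rcons (take i w) c).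
  by rewrite subnn drop0 (take_nth c) ?size_tuple // wi.
case: dP => [/(_ i.+1)|m /andP[_ mi] _ /(_ i.+1)].
  by rewrite -E ltnS leqnn eqxx => /(_ isT).
by rewrite ltnS leqnn => /(_ isT E) im; congr inr; lia.
Qed.

Lemma Larc_succ x y : rank y = (rank x).+1 -> Larc x y.
Proof.
rewrite LarcE /Ledge; case: y => [b|j] // yx.
have jk : rank (inr j : Lvertex w) < k := ltn_ord (val j).
have ik : rank x < k by lia.
have lj : letter w (rank x).+1 (lab (inr j : Lvertex w)).
  by rewrite (@letter_tnth _ (Ordinal ik)) // (lab_rank (i := Ordinal ik)).
move: (lab _) lj => c; case: x yx ik => [a|i] /= yx ik lj; first by rewrite yx lj.
rewrite d_succ // yx eqxx andbT negb_and; apply/orP; left.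
by rewrite /= yx in jk; apply/eqP => /= ei; rewrite ei in jk; lia.
Qed.

Lemma Larc_star x y : rank x = 0 -> rank y <= 1 -> Larc x y.
Proof.
move=> x0 y1; have [yE|yN] := eqVneq (rank y) 1; first by rewrite Larc_succ ?x0.
rewrite LarcE /Ledge; case: x x0 => [a _|i /= i0]; last by have := valP i; rewrite i0.
by case: y y1 yN => [b|[j j0]] //= j1 /eqP jN; lia.
Qed.

Lemma ex_star : 1 < q -> 0 < k -> exists x, rank x = 0.
Proof.
move=> q1 k0; set b := tnth w (Ordinal k0).
have [a ab] : exists a, a != b.
  have /existsP[a aP] : [exists a, a != b]; last by exists a.
  have : 0 < #|[set~ b]| by rewrite cardsC1 card_ord; lia.
  by case/card_gt0P => a; rewrite in_setC1 => ab; apply/existsP; exists a.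
have na : ~~ letter w 1 a by rewrite (@letter_tnth _ (Ordinal k0)) // eq_sym.
by exists (inl (exist _ a na)).
Qed.

(** With [Ledge_total], this identifies w_k as the only letter that labels no
    edge out of the vertex k-1. *)
Lemma Ledge_letter_last x c y :
  Ledge x c y -> 1 < k -> rank x = k.-1 -> ~~ letter w k c.
Proof.
rewrite /Ledge; case: x => [a _ k1 /= a0|i /= + _ ik]; first by lia.
by rewrite ik eqxx => /andP[].
Qed.

(** The labels inject the out-neighbours of x into the alphabet, and miss a
    letter exactly at k-1; this singles out that vertex in the unlabeled graph. *)
Lemma card_out x : 1 < k -> (#|out x| == q) = (rank x != k.-1).
Proof.
move=> k1; have kk : k.-1 < k by lia.
have <- : #|[set lab y | y in out x]| = #|out x|.
  by apply: card_in_imset => y z; rewrite !inE; apply: Larc_lab_inj.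
have [xk|xk] := eqVneq (rank x) k.-1.
  apply/negbTE; rewrite neq_ltn; apply/orP; left.
  rewrite -[X in _ < X]card_ord -cardsT; apply: proper_card.
  apply/properP; split; first exact: subsetT.
  exists (tnth w (Ordinal kk)) => //; apply/imsetP => -[y].
  rewrite inE LarcE => /Ledge_letter_last /(_ k1 xk) + yE.
  by rewrite -yE (@letter_tnth _ (Ordinal kk)) // eqxx.
rewrite -[X in _ == X]card_ord -cardsT; apply/eqP; congr #|pred_of_set _|.
apply/setP => c; rewrite inE; apply/imsetP.
have [|y e] := @Ledge_total x c k1; first by move=> e; rewrite e eqxx in xk.
by exists y; [rewrite inE; apply/existsP; exists c | apply: Ledge_lab e].
Qed.

End Graph.

(** * From an isomorphism to a permutation of the letters *)

Section IsoToPerm.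
Variables (q k : nat) (w w' : k.-tuple 'I_q) (f : Lvertex w -> Lvertex w').
Hypotheses (q1 : 1 < q) (k1 : 1 < k) (f_bij : bijective f).
Hypothesis f_arc : forall x y, Larc x y = Larc (f x) (f y).

Let f_inj : injective f := bij_inj f_bij.

Lemma iso_card_out x : #|out (f x)| = #|out x|.
Proof.
rewrite -(card_imset _ f_inj); apply: eq_card => y; rewrite inE.
have [g fK gK] := f_bij.
by rewrite -[y in LHS]gK -f_arc -[y in RHS]gK (mem_imset _ _ f_inj) inE.
Qed.

(** Downward induction on the rank, starting from k-1.  As y has an
    edge to a vertex of the next rank, and f preserves that rank, f y has rank at
    least that of y; the greater ranks are taken by images of other vertices. *)
Lemma iso_rank x : rank (f x) = rank x.
Proof.
have k0 : 0 < k by lia.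
suff: forall m y, k.-1 - m <= rank y -> rank (f y) = rank y.
  by move/(_ k.-1 x); rewrite subnn; apply.
elim=> [|m IH] y ym.
  have yk : rank y = k.-1 by have := rank_lt y k0; lia.
  have := card_out (f y) k1; rewrite iso_card_out card_out // yk eqxx.
  by move/negb_inj/esym/eqP.
have [/IH //|ym'] := leqP (k.-1 - m) (rank y).
have [z zy] : exists z : Lvertex w, rank z = (rank y).+1 by apply: ex_rank; lia.
have := Larc_succ zy; rewrite f_arc => /Larc_rank; rewrite IH ?zy ?ltnS; last lia.
rewrite leq_eqVlt => /orP[/eqP //|lt_yf].
(* The only vertex with the rank of f y is also the image of t, so t = y. *)
have [t tf] : exists t : Lvertex w, rank t = rank (f y).
  by apply: ex_rank; have := rank_lt (f y) k0; lia.
have ft : rank (f t) = rank t by apply: IH; lia.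
have /f_inj ty : f t = f y by apply: rank_inj; lia.
by move: lt_yf; rewrite -tf ty ltnn.
Qed.

(** Among the out-neighbours of a vertex every label occurs once, so f induces
    an injective renaming of the labels of the edges out of that vertex; the
    claim is that one permutation gives the renaming at all vertices. *)
Lemma iso_lab : exists pi : {perm 'I_q}, forall y, lab (f y) = pi (lab y).
Proof.
have [x x0] := ex_star w q1 (ltnW k1).
have xN : rank x <> k.-1 by lia.
have /fin_all_exists[r rP] c : exists y, Ledge x c y by apply: Ledge_total => // /xN.
have labr c : lab (r c) = c by rewrite -(Ledge_lab (rP c)).
have arcr c : Larc x (r c) by apply/existsP; exists c.
have pi_inj : injective (fun c => lab (f (r c))).
  move=> c c' e; rewrite -[c]labr -[c']labr; congr lab; apply: f_inj.
  by apply: (@Larc_lab_inj _ _ _ (f x)) e; rewrite -f_arc.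
(* The vertices of rank at most 1 are the out-neighbours of x, so pi is right on
   them by construction; those of larger rank follow by induction. *)
exists (perm pi_inj) => y; have [n yn] := ubnP (rank y).
elim: n y yn => // n IH y yn.
have [y1|y1] := leqP (rank y) 1.
  rewrite permE; congr (lab (f _)).
  by apply: (@Larc_lab_inj _ _ _ x); rewrite ?labr ?arcr ?Larc_star.
have [z zy] : exists z : Lvertex w, rank z = (rank y).-1.
  by apply: ex_rank; have := rank_lt y (ltnW k1); lia.
have zarc : Larc z y by apply: Larc_succ; lia.
(* c is the letter whose image is the label of f y.  If its edge from z led to
   some t <> y, then t would have smaller rank than y, and f z would have edges
   with the same label to f t and f y. *)
have [c cE] : exists c, perm pi_inj c = lab (f y).
  by exists ((perm pi_inj)^-1%g (lab (f y))); rewrite permKV.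
have [t et] : exists t, Ledge z c t.
  by apply: Ledge_total => //; have := rank_lt y (ltnW k1); lia.
have arct : Larc z t by apply/existsP; exists c.
have ct := Ledge_lab et.
suff ty : t = y by rewrite -cE ct ty.
have [ty|ty] := eqVneq (rank t) (rank y); first by apply: rank_inj; lia.
have lt : rank t < n by have := Larc_rank arct; lia.
by apply: f_inj; apply: (@Larc_lab_inj _ _ _ (f z)); rewrite -?f_arc // IH // -ct cE.
Qed.

(** The letters w_j with j < k are labels of vertices; the last letter is found
    as the one that labels no edge out of k-1. *)
Lemma iso_perm :
  exists pi : {perm 'I_q}, forall i : 'I_k, pi (tnth w i) = tnth w' i.
Proof.
have [pi piP] := iso_lab; exists pi => i.
have [ik|ik] := ltnP i.+1 k.
  have [y yi] : exists y : Lvertex w, rank y = i.+1 by apply: ex_rank.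
  by rewrite -(lab_rank yi) -piP (lab_rank (i := i)) // iso_rank.
have ei : k.-1 = i by have := ltn_ord i; lia.
have [x xk] : exists x : Lvertex w, rank x = k.-1 by apply: ex_rank; lia.
set c := (pi^-1)%g (tnth w' i).
have pic : pi c = tnth w' i by rewrite permKV.
have [wc|wc] := boolP (letter w k c).
  by move: wc; rewrite (letter_tnth _ _ ei) => /eqP ->.
have [y e] := @Ledge_total _ _ _ x c k1 (fun=> wc).
have : Larc (f x) (f y) by rewrite -f_arc; apply/existsP; exists c.
rewrite LarcE piP -(Ledge_lab e) pic => /Ledge_letter_last.
by rewrite iso_rank => /(_ k1 xk); rewrite (letter_tnth _ _ ei) eqxx.
Qed.

End IsoToPerm.

(** * From a permutation of the letters to an isomorphism *)

Section PermToIso.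
Variables (q k : nat) (w w' : k.-tuple 'I_q) (pi : {perm 'I_q}).
Hypothesis piw : forall i : 'I_k, pi (tnth w i) = tnth w' i.

Lemma perm_word : map pi w = w' :> seq _.
Proof.
suff -> : w' = map_tuple pi w by [].
by apply: eq_from_tnth => i; rewrite tnth_map piw.
Qed.

Lemma perm_letter i a : letter w' i (pi a) = letter w i a.
Proof.
rewrite /letter -perm_word onth_map.
by case: onth => //= b; rewrite !(inj_eq Some_inj) (inj_eq perm_inj).
Qed.

Definition perm_name (n : 'I_q + nat) : 'I_q + nat :=
  match n with inl a => inl (pi a) | inr j => inr j end.

Lemma perm_d i a : d w' i (pi a) = perm_name (d w i a).
Proof.
suff eqd : dset w' i (pi a) = dset w i a by rewrite /d eqd; case: (dset w i a).
apply: eq_filter => j; rewrite -perm_word -!map_take -map_rcons -map_drop.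
exact/inj_eq/inj_map/perm_inj.
Qed.

Definition perm_vertex (x : Lvertex w) : Lvertex w' :=
  match x with
  | inl a => inl (exist _ (pi (val a))
               (eq_ind_r (fun b => ~~ b) (valP a) (perm_letter 1 (val a))))
  | inr i => inr i
  end.

Lemma perm_vname x : vname (perm_vertex x) = perm_name (vname x).
Proof. by case: x. Qed.

Lemma perm_name_inj : injective perm_name.
Proof. by move=> [a|i] [b|j] //= [] /perm_inj ->. Qed.

Lemma perm_vertex_inj : injective perm_vertex.
Proof.
move=> x y /(congr1 (@vname q k w')); rewrite !perm_vname.
by move/perm_name_inj/vname_inj.
Qed.

Lemma perm_Ledge x c y :
  Ledge (perm_vertex x) (pi c) (perm_vertex y) = Ledge x c y.
Proof.
rewrite /Ledge !perm_vname; case: (vname x) => [a|i] /=.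
  by case: (vname y) => [b|j] /=; rewrite ?perm_letter ?(inj_eq perm_inj).
by rewrite perm_letter perm_d (inj_eq perm_name_inj).
Qed.

Lemma perm_Larc x y : Larc x y = Larc (perm_vertex x) (perm_vertex y).
Proof.
apply/existsP/existsP => -[c e]; first by exists (pi c); rewrite perm_Ledge.
by exists ((pi^-1)%g c); rewrite -perm_Ledge permKV.
Qed.

End PermToIso.

Theorem corollary3p9 (q k : nat) (hq : 2 <= q) (hk : 2 <= k)
    (w w' : k.-tuple 'I_q) :
  digraph_iso (@Larc q k w) (@Larc q k w') <->
  exists pi : {perm 'I_q}, forall i : 'I_k, pi (tnth w i) = tnth w' i.
Proof.
split=> [[f f_bij f_arc]|[pi piw]]; first exact: iso_perm f_arc.
have piVw i : (pi^-1)%g (tnth w' i) = tnth w i by rewrite -piw permK.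
exists (perm_vertex piw); last exact: perm_Larc.
(* The inverse permutation gives an injection the other way, so the two finite
   vertex sets have the same size and both injections are bijective. *)
exact: inj_card_bij (@perm_vertex_inj _ _ _ _ _ piw)
  (leq_card _ (@perm_vertex_inj _ _ _ _ _ piVw)).
Qed.
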